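(* Let $U\subset\mathbb{C}$ be the open unit disc. If $f(z)=\sum_{k=0}^\infty a_k z^k\in H^1(U)$ and $S_Nf(z)=\sum_{k=0}^N a_k z^k$, then $$\left\|S_Nf-f\right\|_{A^1(U)}\longrightarrow 0\qquad\text{as } N\to\infty.$$
   Context: $U=\{z\in\mathbb{C}:|z|<1\}$ and $\mathcal{O}(U)$ is the set of holomorphic functions on $U$. The Hardy space $H^1(U)$ is the set of $f\in\mathcal{O}(U)$ such that $$\|f\|_{H^1(U)}=\sup_{0\le r<1}\frac{1}{2\pi}\int_0^{2\pi}|f(re^{i\theta})|\,d\theta<\infty,$$ where $d\theta$ is Lebesgue measure on $[0,2\pi]$. The Bergman space $A^1(U)$ is the set of $f\in\mathcal{O}(U)$ such that $\|f\|_{A^1(U)}=\int_U|f|\,dV<\infty$, where $dV$ is Lebesgue (area) measure on $\mathbb{C}$. *)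

(* Defs.v *)
From HB Require Import structures.
From mathcomp Require Import all_boot all_order all_algebra.
From mathcomp Require Import complex.
From mathcomp Require Import all_classical all_reals all_analysis.
Set Implicit Arguments.
Unset Strict Implicit.
Unset Printing Implicit Defensive.
Import Order.TTheory GRing.Theory Num.Theory.
Import numFieldNormedType.Exports.
Import Normc.
Local Open Scope classical_set_scope.
Local Open Scope ring_scope.
Local Open Scope complex_scope.

(* [normc z : R] is the modulus of [z : R[i]]; it is used where a real value is
   needed, since [`|z|] lives in R[i].  The topology of the complex plane is the
   one of [R[i]^o], i.e. R[i] as a normed module over itself; in particular
   [derivable] over R[i]^o is complex differentiability. *)

Definition unit_disc (R : realType) : set R[i] := [set z | normc z < 1].

Definition holomorphic_on (R : realType) (D : set R[i]) (f : R[i] -> R[i]) :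
    Prop :=
  forall z, D z -> derivable (f : R[i]^o -> R[i]^o) z 1.

(* e^(it) *)
Definition cis (R : realType) (t : R) : R[i] := cos t +i* sin t.

Definition H1norm (R : realType) (f : R[i] -> R[i]) : \bar R :=
  ereal_sup [set (((2 * pi)^-1)%:E *
    \int[lebesgue_measure]_(t in `[0%R, (2 * pi)%R])
      (normc (f (r%:C * cis t)))%:E)%E | r in `[0%R, 1%R[].

Definition hardyH1 (R : realType) (f : R[i] -> R[i]) : Prop :=
  holomorphic_on (@unit_disc R) f /\ (H1norm f < +oo)%E.

(* The plane is identified with R * R, where area is the product Lebesgue
   measure. *)
Definition A1norm (R : realType) (f : R[i] -> R[i]) : \bar R :=
  (\int[lebesgue_measure \x lebesgue_measure]_(p in
      [set p : R * R | unit_disc (p.1 +i* p.2)])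
    (normc (f (p.1 +i* p.2)))%:E)%E.

Definition partial_sum (R : realType) (a : nat -> R[i]) (N : nat) (z : R[i]) :
    R[i] :=
  \sum_(k < N.+1) a k * z ^+ k.

(* Main.v *)
Require Import Defs.
From HB Require Import structures.
From mathcomp Require Import all_boot all_order all_algebra.
From mathcomp Require Import complex.
From mathcomp Require Import all_classical all_reals all_analysis.
From mathcomp Require Import measurable_realfun ring lra.
Set Implicit Arguments.
Unset Strict Implicit.
Unset Printing Implicit Defensive.
Import Order.TTheory GRing.Theory Num.Theory.
Import numFieldNormedType.Exports.
Local Open Scope classical_set_scope.
Local Open Scope ring_scope.
Local Open Scope complex_scope.

(** Write [rho] for the modulus of [z], and [S_N] for the partial sums of [f].

    The area measure of the plane is invariant under rotations, so the area
    integral of |S_N - f| over the disc does not change when the integrand is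
    replaced by its mean over the circle through the point of integration
    ([integral_rotation_mean]).  This replaces polar coordinates.  It remains to
    apply dominated convergence to these circle means, [circle_error] (up to the
    factor 2 pi), as [N] tends to infinity.

    They tend to 0 at every point of the disc, because a power series converges
    uniformly, even geometrically, on smaller circles ([partial_sum_error]).

    They are dominated as follows.  The circle mean of |f| is at most the Hardy
    norm of [f].  Put r = sqrt rho.  Comparing Fourier coefficients, the function
    t |-> S_N (rho e^(it)) is the convolution of t |-> f (r e^(it)) with the
    kernel D (e^(it)) = sum_(k <= N) r^k e^(ikt), so its mean is at most the Hardy
    norm of [f] times the mean of |D|.  By Parseval the mean of |D|^2 is
    sum_(k <= N) rho^k <= 1 / (1 - rho), so the mean of |D| is at most
    1 / sqrt (1 - rho), uniformly in [N] ([partial_sum_circle]).  On a fixed circle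
    the L^1 norm of [S_N] is not controlled uniformly in [N] by that of [f] on the
    same circle; moving from radius rho to radius sqrt rho pays for this with a
    factor that is unbounded near the unit circle but integrable over the disc
    ([integral_disc_weight]).

    The convolution is carried out on the M-th roots of unity, with [M] > [N] and
    [f] replaced by [S_(M-1)]: no frequency reaches [M], so the discrete formula
    is exact ([root_convolution]), and [M] tends to infinity only in the final
    estimate.  Complex integration is thereby avoided. *)

(** * Translation and rotation invariance of Lebesgue measure *)

Section Measure.
Context {R : realType}.
Notation mu := (@lebesgue_measure R).
Notation TR := (measurableTypeR R).
Implicit Types g : TR -> \bar R.

Lemma measurable_shift (c : R) :
  measurable_fun [set: TR] (fun x : TR => x + c : TR).
Proof. by apply: measurable_funD => //; exact: measurable_cst. Qed.

Lemma integral_shift g (c : R) :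
  measurable_fun setT g -> (forall x, 0 <= g x)%E ->
  (\int[mu]_x g (x + c)%R = \int[mu]_x g x)%E.
Proof.
move=> mg g0.
have mc := measurable_shift c.
pose phi : {mfun measurableTypeR R >-> measurableTypeR R} :=
  HB.pack (fun x : R => x + c) (isMeasurableFun.Build _ _ _ _ _ mc).
have muE A : measurable A -> mu A = pushforward mu phi A.
  move=> mA; apply: lebesgue_measure_unique => // X [[a b] /= _ <-].
  rewrite /pushforward /=.
  have -> : (fun x : R => x + c) @^-1` `]a, b] = `]a - c, b - c]%classic.
    by apply/seteqP; split=> x /=; rewrite !in_itv /= ltrBlDr lerBrDr.
  rewrite !lebesgue_measure_itv /= !lte_fin ltrD2r.
  by case: ifP => // _; rewrite -!EFinB opprB addrA subrK.
have := @ge0_integral_pushforward _ _ _ _ R _ mc mu setT g measurableT mg.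
rewrite preimage_setT => <-; last by move=> y _; exact: g0.
by apply: eq_measure_integral => A mA _; rewrite [RHS]muE.
Qed.

Lemma integral_itv_shift g (a b c : R) :
  measurable_fun setT g -> (forall x, 0 <= g x)%E ->
  (\int[mu]_(x in `[a, b[) g (x + c)%R =
   \int[mu]_(x in `[(a + c)%R, (b + c)%R[) g x)%E.
Proof.
move=> mg g0.
rewrite integral_mkcond [RHS]integral_mkcond.
rewrite -(@integral_shift (g \_ `[(a + c)%R, (b + c)%R[) c).
- by apply: eq_integral => x _; rewrite /patch !mem_setE !in_itv /= lerD2r ltrD2r.
- by apply/(measurable_restrictT _ _).1 => //; exact: measurable_funTS.
- by move=> x; apply: erestrict_ge0.
Qed.

(** The part of the integral that a shift pushes beyond one end of the period
    comes back at the other end. *)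
Lemma periodic_integral_shift g (T c : R) :
  0 < T -> (forall x, g (x + T)%R = g x) ->
  measurable_fun setT g -> (forall x, 0 <= g x)%E ->
  `|c| <= T ->
  (\int[mu]_(x in `[0%R, T]) g (x + c)%R = \int[mu]_(x in `[0%R, T]) g x)%E.
Proof.
(* On half-open intervals the pieces are disjoint and no endpoint is counted
   twice. *)
have pos (h : TR -> \bar R) d : 0 < T -> (forall x, h (x + T)%R = h x) ->
  measurable_fun setT h -> (forall x, 0 <= h x)%E -> 0 <= d <= T ->
  (\int[mu]_(x in `[0%R, T]) h (x + d)%R = \int[mu]_(x in `[0%R, T]) h x)%E.
  move=> T0 hT mh h0 /andP[d0 dT].
  have cut (k : TR -> \bar R) (a b e : R) : measurable_fun setT k ->
      (forall x, 0 <= k x)%E -> a <= b <= e ->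
      (\int[mu]_(x in `[a, e[) k x =
       \int[mu]_(x in `[a, b[) k x + \int[mu]_(x in `[b, e[) k x)%E.
    move=> mk k0 /andP[ab be].
    have E : `[a, e[%classic = `[a, b[ `|` `[b, e[.
      by apply/seteqP; split=> x /=; rewrite !in_itv /=; lra.
    rewrite E ge0_integral_setU//.
    - exact: measurable_funTS.
    - apply/disj_set2P; apply/seteqP; split=> x //= []; rewrite !in_itv /=; lra.
  have md : measurable_fun [set: TR] (fun x : R => h (x + d)%R).
    by apply: (measurableT_comp mh); exact: measurable_shift.
  have cl (k : TR -> \bar R) : measurable_fun setT k ->
     (\int[mu]_(x in `[0%R, T]) k x = \int[mu]_(x in `[0%R, T[) k x)%E.
    by move=> mk; rewrite integral_itv_bndo_bndc//; exact: measurable_funTS.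
  rewrite (cl _ md) (cl _ mh) integral_itv_shift// add0r.
  rewrite (cut h d T (T + d))//; last by lra.
  rewrite (cut h 0 d T)//; last by lra.
  rewrite addeC; congr (_ + _)%E.
  rewrite -{1}(add0r T) (addrC T d) -integral_itv_shift//.
  by apply: eq_integral => x _; rewrite hT.
move=> T0 gT mg g0; rewrite ler_norml => /andP[c1 c2].
have [c0|c0] := leP 0 c; first by apply: pos => //; rewrite c0 c2.
have := pos (fun x : R => g (x + c)%R) (- c) T0.
(* A negative shift is undone by a positive one. *)
move=> <-.
- by apply: eq_integral => x _; rewrite subrK.
- by move=> x; rewrite addrAC gT.
- by apply: (measurableT_comp mg); exact: measurable_shift.
- by move=> x.
- by rewrite oppr_ge0 (ltW c0) /= lerNl.
Qed.

Notation area := (lebesgue_measure \x lebesgue_measure)%E.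
Implicit Types F : TR * TR -> \bar R.

Lemma measurable_linear_plane (a b c d : R) :
  measurable_fun setT (fun p : TR * TR =>
    (a * p.1 + b * p.2, c * p.1 + d * p.2) : TR * TR).
Proof.
have m u v : measurable_fun setT (fun p : TR * TR => u * p.1 + v * p.2).
  by apply: measurable_funD; apply: measurable_funM => //;
    exact: measurable_cst.
by apply: (@measurable_fun_pair _ _ _ _ TR TR); exact: m.
Qed.

(** By Tonelli's theorem a shear acts on each line of one of the two foliations
    as a translation. *)
Lemma integral_shear F (a : R) :
  measurable_fun setT F -> (forall p, 0 <= F p)%E ->
  (\int[area]_p F (p.1 + a * p.2, p.2)%R = \int[area]_p F p)%E /\
  (\int[area]_p F (p.1, a * p.1 + p.2)%R = \int[area]_p F p)%E.
Proof.
move=> mF F0; split.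
- rewrite fubini_tonelli2 //; last first.
    have := measurable_linear_plane 1 a 0 1.
    under eq_fun do rewrite !mul1r mul0r add0r.
    exact: measurableT_comp.
  rewrite [RHS](fubini_tonelli2 F mF F0); apply: eq_integral => y _.
  rewrite /fubini_G /= (integral_shift (g := fun x => F (x, y)))//.
  by apply: (measurableT_comp mF); exact: measurable_pair2.
- rewrite fubini_tonelli1 //; last first.
    have := measurable_linear_plane 1 0 a 1.
    under eq_fun do rewrite !mul1r mul0r addr0.
    exact: measurableT_comp.
  rewrite [RHS](fubini_tonelli1 F mF F0); apply: eq_integral => x _.
  rewrite /fubini_F /=; under eq_integral do rewrite addrC.
  rewrite (integral_shift (g := fun y => F (x, y)))//.
  by apply: (measurableT_comp mF); exact: measurable_pair1.
Qed.

(** A rotation other than the half turn is a product of three shears,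
    horizontal, vertical, horizontal; the half turn is the square of the quarter
    turn. *)
Lemma integral_rotation F (c s : R) : c ^+ 2 + s ^+ 2 = 1 ->
  measurable_fun setT F -> (forall p, 0 <= F p)%E ->
  (\int[area]_p F (c * p.1 - s * p.2, s * p.1 + c * p.2)%R =
   \int[area]_p F p)%E.
Proof.
have three (c' s' : R) (G : TR * TR -> \bar R) :
  c' ^+ 2 + s' ^+ 2 = 1 -> 1 + c' != 0 ->
  measurable_fun setT G -> (forall p, 0 <= G p)%E ->
  (\int[area]_p G (c' * p.1 - s' * p.2, s' * p.1 + c' * p.2)%R =
   \int[area]_p G p)%E.
  move=> cs c1 mG G0.
  (* - tan (t / 2), when c' = cos t and s' = sin t *)
  pose a := - (s' / (1 + c')).
  rewrite -(integral_shear a mG G0).1.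
  have m1 : measurable_fun setT (fun p : TR * TR => G (p.1 + a * p.2, p.2)).
    have := measurable_linear_plane 1 a 0 1.
    under eq_fun do rewrite !mul1r mul0r add0r.
    exact: measurableT_comp.
  rewrite -(integral_shear s' m1 _).2//=.
  have m2 : measurable_fun setT (fun p : TR * TR =>
     G (p.1 + a * (s' * p.1 + p.2), (s' * p.1 + p.2))).
    have := measurable_linear_plane (1 + a * s') a s' 1.
    under eq_fun do rewrite !mul1r mulrDl -addrA mul1r -mulrA -mulrDr.
    exact: measurableT_comp.
  rewrite -(integral_shear a m2 _).1//=.
  apply: eq_integral => -[x y] _ /=; congr (G (_, _)).
  - have e : s' * s' = (1 - c') * (1 + c') by lra.
    rewrite /a; field: e; exact: c1.
  - have e : s' * s' = (1 - c') * (1 + c') by lra.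
    rewrite /a; field: e; exact: c1.
move=> cs mF F0.
(* [three] divides by 1 + c, which vanishes for the half turn only. *)
have [c1|] := eqVneq (1 + c) 0; last by move=> c1; exact: three.
have cE : c = -1 by lra.
have s0 : s = 0 by move: cs; rewrite cE; nra.
have q01 : (0 : R) ^+ 2 + 1 ^+ 2 = 1 by ring.
have q1 : (1 : R) + 0 != 0 by rewrite addr0 oner_eq0.
rewrite -(three 0 1 F q01 q1 mF F0).
pose F1 p := F (0 * p.1 - 1 * p.2, 1 * p.1 + 0 * p.2).
have mF1 : measurable_fun setT F1.
  have := measurable_linear_plane 0 (-1) 1 0.
  under eq_fun do rewrite mulNr.
  exact: measurableT_comp.
rewrite -/F1 -(three 0 1 F1 q01 q1 mF1); last by move=> p; exact: F0.
rewrite /F1 /=.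
by apply: eq_integral => -[x y] _ /=; rewrite cE s0; congr (F (_, _)); ring.
Qed.

End Measure.

(** * Power series: geometric convergence on smaller discs *)

Section Complex.
Context {R : realType}.
Local Notation normc := (@Normc.normc R).
Implicit Types (z w : R[i]) (a : nat -> R[i]).

Lemma normrE z : `|z| = (normc z)%:C. Proof. by case: z. Qed.

Lemma normcR (x : R) : normc x%:C = `|x|.
Proof. by rewrite /= expr0n /= addr0 sqrtr_sqr. Qed.

Lemma normcX z n : normc (z ^+ n) = normc z ^+ n.
Proof.
by elim: n => [|n IH]; rewrite ?expr0 ?Normc.normc1// !exprS Normc.normcM IH.
Qed.

Lemma normc_ge0 z : 0 <= normc z.
Proof. by case: z => x y; exact: sqrtr_ge0. Qed.

Lemma ler_normcD z w : normc (z + w) <= normc z + normc w.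
Proof. exact: le_normcD. Qed.

Lemma normcNE z : normc (- z) = normc z. Proof. exact: normcN. Qed.

Lemma normcB z w : normc (z - w) = normc (w - z).
Proof. by rewrite -normcNE opprB. Qed.

Lemma ler_normc_sum (I : Type) (s : seq I) (P : pred I) (F : I -> R[i]) :
  normc (\sum_(i <- s | P i) F i) <= \sum_(i <- s | P i) normc (F i).
Proof.
elim/big_ind2 : _ => //; first by rewrite Normc.normc0.
by move=> x u y v xu yv; exact/(le_trans (ler_normcD _ _))/lerD.
Qed.

Lemma mulc_conj z : z * conjc z = (normc z ^+ 2)%:C.
Proof. by rewrite -sqr_normc normrE rmorphXn. Qed.

Lemma cvg_normcB (u : nat -> R[i]) (l : R[i]) :
  ((u n : R[i]^o) @[n --> \oo] --> (l : R[i]^o)) ->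
  normc (u n - l) @[n --> \oo] --> (0 : R).
Proof.
move=> /cvgrPdist_lt ul; apply/cvgrPdist_lt => e e0.
have e0' : 0 < e%:C :> R[i] by rewrite ltcR.
apply: filterS (ul _ e0') => n.
by rewrite normrE ltcR sub0r normrN ger0_norm ?normc_ge0// normcB.
Qed.

Lemma partial_sumS a N z :
  partial_sum a N.+1 z = partial_sum a N z + a N.+1 * z ^+ N.+1.
Proof. by rewrite /partial_sum big_ord_recr. Qed.

(** The terms of a convergent series are bounded, being differences of
    consecutive members of a bounded sequence. *)
Lemma coef_bound a z (l : R[i]) :
  ((partial_sum a n z : R[i]^o) @[n --> \oo] --> (l : R[i]^o)) ->
  exists2 B, 0 <= B & forall k, normc (a k) * normc z ^+ k <= B.
Proof.
move=> /cvg_normcB ul.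
have /cvg_seq_bounded/pinfty_ex_gt0[K K0 /= uK] : cvg
  (normc (partial_sum a n z - l) @[n --> \oo]) by apply/cvg_ex; exists 0.
have dK n : normc (partial_sum a n z - l) <= K.
  by rewrite -(ger0_norm (normc_ge0 _)); exact: uK.
exists (2 * K + normc l); first by rewrite addr_ge0 ?normc_ge0 ?mulr_ge0// ltW.
move=> k; rewrite -normcX -Normc.normcM; case: k => [|k].
  have -> : a 0%N * z ^+ 0 = (partial_sum a 0 z - l) + l.
    by rewrite subrK /partial_sum big_ord1.
  rewrite (le_trans (ler_normcD _ _))// lerD2r (le_trans (dK _))//.
  by rewrite ler_peMl ?ltW// ltr1n.
have -> : a k.+1 * z ^+ k.+1 =
    (partial_sum a k.+1 z - l) + (l - partial_sum a k z).
  by rewrite partial_sumS; ring.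
rewrite (le_trans (ler_normcD _ _))// (normcB l).
have := dK k; have := dK k.+1; have := normc_ge0 l; lra.
Qed.

Lemma partial_sum_diff a N z m :
  partial_sum a (N + m) z - partial_sum a N z =
  \sum_(i < m) a (N.+1 + i)%N * z ^+ (N.+1 + i).
Proof.
elim: m => [|m IH]; first by rewrite addn0 subrr big_ord0.
by rewrite addnS partial_sumS addrAC IH big_ord_recr /= addSn.
Qed.

(** The terms at an intermediate radius [r] are bounded, so at radius [rho] the
    tail is dominated by a geometric series of ratio rho / r. *)
Lemma partial_sum_error a (f : R[i] -> R[i]) (rho : R) :
  (forall z, unit_disc z ->
     (partial_sum a n z : R[i]^o) @[n --> \oo] --> (f z : R[i]^o)) ->
  0 <= rho < 1 ->
  exists B q, [/\ 0 <= B, 0 <= q < 1 & forall z N, normc z <= rho ->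
    normc (partial_sum a N z - f z) <= B * q ^+ N].
Proof.
move=> af /andP[rho0 rho1].
pose r := (1 + rho) / 2.
have r0 : 0 < r by rewrite /r; lra.
have r1 : r < 1 by rewrite /r; lra.
have rhor : rho < r by rewrite /r; lra.
have nr : normc r%:C = r by rewrite normcR gtr0_norm.
have ur : unit_disc r%:C by rewrite /unit_disc /mkset nr.
have [B B0 aB] := coef_bound (af _ ur).
rewrite nr in aB.
have [q [q0 q1 rq]] : exists q, [/\ 0 <= q, q < 1 & rho = q * r].
  exists (rho / r); rewrite divr_ge0 ?(ltW r0)// ltr_pdivrMr// mul1r.
  by rewrite mulrVK ?unitfE ?gt_eqF.
exists (B / (1 - q)), q; split; rewrite ?q0 ?q1//.
  by rewrite divr_ge0// subr_ge0 ltW.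
move=> z N zr.
have uz : unit_disc z by rewrite /unit_disc /mkset; exact: le_lt_trans rho1.
have partB m :
    normc (partial_sum a N z - partial_sum a (N + m) z) <= B / (1 - q) * q ^+ N.
  rewrite normcB partial_sum_diff (le_trans (ler_normc_sum _ _ _))//.
  have term i : normc (a (N.+1 + i)%N * z ^+ (N.+1 + i)) <= B * q ^+ N * q ^+ i.
    rewrite Normc.normcM normcX.
    have zq : normc z ^+ (N.+1 + i) <= q ^+ (N.+1 + i) * r ^+ (N.+1 + i).
      by rewrite -exprMn -rq lerXn2r// nnegrE ?normc_ge0.
    have : normc (a (N.+1 + i)%N) * normc z ^+ (N.+1 + i) <=
        normc (a (N.+1 + i)%N) * r ^+ (N.+1 + i) * q ^+ (N.+1 + i).
      by rewrite -mulrA (mulrC (r ^+ _)) ler_wpM2l ?normc_ge0.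
    move=> /le_trans; apply; rewrite -(mulrA B) -exprD.
    apply: ler_pM; rewrite ?exprn_ge0 ?mulr_ge0 ?normc_ge0 ?exprn_ge0 ?(ltW r0)//.
    by apply: ler_wiXn2l; rewrite ?q0 ?(ltW q1)// leq_add2r leqnSn.
  apply: (@le_trans _ _ (\sum_(i < m) B * q ^+ N * q ^+ i)).
    by apply: ler_sum => i _; exact: term.
  rewrite -mulr_sumr mulrAC ler_wpM2r ?exprn_ge0// ler_wpM2l//.
  rewrite -[leRHS]mul1r ler_pdivlMr ?subr_gt0//.
  have := subrX1 q m; have : 0 <= q ^+ m by rewrite exprn_ge0.
  by rewrite mulrC; lra.
(* [partB] bounds the distance to a later partial sum; that partial sum is taken
   arbitrarily close to the limit. *)
apply/ler_addgt0Pr => e e0.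
have /cvgrPdist_lt/(_ _ e0)[M _ MP] := cvg_normcB (af _ uz).
have := MP (N + M)%N (leq_addl _ _).
rewrite sub0r normrN ger0_norm ?normc_ge0// => lt_e.
have -> : partial_sum a N z - f z =
  (partial_sum a N z - partial_sum a (N + M) z) + (partial_sum a (N + M) z - f z) by ring.
by rewrite (le_trans (ler_normcD _ _))// lerD// ltW.
Qed.

End Complex.

(** * Convolution on roots of unity *)

Section Roots.
Context {R : realType}.
Local Notation normc := (@Normc.normc R).
Implicit Types (z w : R[i]) (a : nat -> R[i]).

Lemma cisD (s t : R) : cis (s + t) = cis s * cis t.
Proof. by rewrite /cis sinD cosD; congr (_ +i* _); rewrite addrC mulrC. Qed.

Lemma cis0 : cis (0 : R) = 1. Proof. by rewrite /cis sin0 cos0. Qed.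

Lemma cisMn (t : R) n : cis (t *+ n) = cis t ^+ n.
Proof.
by elim: n => [|n IH]; rewrite ?cis0// mulrS cisD IH exprS.
Qed.

Lemma normc_cis (t : R) : normc (cis t) = 1.
Proof. by rewrite /cis /= cos2Dsin2 sqrtr1. Qed.

Lemma cis_2pi (t : R) : cis (t + 2 * pi) = cis t.
Proof. by rewrite /cis mulr_natl sinD2pi cosD2pi. Qed.

(** The argument is plus or minus the arc cosine of the normalized real part,
    according to the sign of the imaginary part. *)
Lemma polar_form z : exists2 t : R, `|t| <= 2 * pi & z = (normc z)%:C * cis t.
Proof.
have [->|z0] := eqVneq z 0.
  exists 0; first by rewrite normr0 mulr_ge0// pi_ge0.
  by rewrite Normc.normc0 mul0r.
have n0 : 0 < normc z.
  rewrite lt_def normc_ge0 andbT; apply: contra z0 => /eqP.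
  by move=> /Normc.eq0_normc ->.
case: z z0 n0 => x y _; set n := normc _ => n0.
have n2 : n ^+ 2 = x ^+ 2 + y ^+ 2.
  by rewrite /n /= sqr_sqrtr// addr_ge0// sqr_ge0.
have c1 : -1 <= x / n <= 1.
  rewrite ler_pdivlMr// ler_pdivrMr// mulN1r mul1r -ler_norml.
  rewrite -(@ler_pXn2r _ 2) ?nnegrE ?(ltW n0)// real_normK ?num_real//.
  by rewrite n2 lerDl sqr_ge0.
have n0' : n != 0 by rewrite gt_eqF.
have sE : Num.sqrt (1 - (x / n) ^+ 2) = `|y| / n.
  have -> : 1 - (x / n) ^+ 2 = (y / n) ^+ 2.
    have -> : 1 = n ^+ 2 / n ^+ 2 by rewrite divff// sqrf_eq0.
    by rewrite !expr_div_n n2; field; rewrite ?n0' // -n2 sqrf_eq0.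
  by rewrite sqrtr_sqr normrM normfV (gtr0_norm n0).
have ap := acos_lepi c1; have a0 := acos_ge0 c1.
have p0 := @pi_gt0 R.
have ac : cos (acos (x / n)) = x / n by rewrite acosK// in_itv.
have [y0|y0] := leP 0 y.
- exists (acos (x / n)); first by rewrite ger0_norm//; lra.
  rewrite /cis ac sin_acos// sE ger0_norm//; simpc.
  by congr (_ +i* _); field.
- exists (- acos (x / n)); first by rewrite normrN ger0_norm//; lra.
  rewrite /cis cosN sinN ac sin_acos// sE ltr0_norm//; simpc.
  by congr (_ +i* _); field.
Qed.

(** 1 - cos t = 2 (sin (t / 2))^2, and the sine is positive on (0, pi). *)
Lemma cis_eq1 (t : R) : 0 < t < 2 * pi -> cis t != 1.
Proof.
move=> /andP[t0 t2]; apply/eqP => -[ct _].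
have s0 : 0 < sin (t / 2) by apply: sin_gt0_pi; lra.
move: ct; have {1}-> : t = (t / 2) *+ 2 by rewrite -mulr_natr; field.
rewrite cos_mulr2n cos2sin2 => /eqP; apply/negP; rewrite lt_eqF//.
by have := exprn_gt0 2 s0; rewrite mulr2n; lra.
Qed.

Lemma cis_primitive_root M : (0 < M)%N ->
  M.-primitive_root (cis (2 * pi / M%:R : R)).
Proof.
move=> M0; rewrite /primitive_root_of_unity M0; apply/forallP => i.
rewrite unity_rootE -cisMn; apply/eqP.
have p0 := @pi_gt0 R.
have M0' : 0 < M%:R :> R by rewrite ltr0n.
have Mn0 : M%:R != 0 :> R by rewrite gt_eqF.
have [->|iM] := eqVneq i.+1 M.
  by rewrite -(mulr_natr (2 * pi / M%:R)) mulfVK //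
    -(add0r (2 * pi)) cis_2pi cis0 eqxx.
apply/negbTE/cis_eq1; rewrite -(mulr_natr (2 * pi / M%:R)); apply/andP; split.
  by rewrite !mulr_gt0 ?invr_gt0.
rewrite mulrAC ltr_pdivrMr// ltr_pM2l ?mulr_gt0// ltr_nat.
by rewrite ltn_neqAle iM ltn_ord.
Qed.

(** Convolution theorem on the group of M-th roots of unity: the characters are
    orthogonal, and all frequencies occurring are below [M], so distinct ones stay
    distinct modulo [M].  With d = c^* and |w| = 1 this is Parseval's identity. *)
Lemma root_convolution (F : fieldType) M (w : F) (c d : nat -> F) n m :
  M.-primitive_root w -> (n <= m <= M)%N ->
  \sum_(j < M) (\sum_(l < m) c l * (w ^+ j) ^+ l) *
               (\sum_(k < n) d k * (w ^+ j)^-1 ^+ k) =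
  M%:R * \sum_(k < n) c k * d k.
Proof.
move=> pw /andP[nm mM].
have M0 := prim_order_gt0 pw.
have w0 : w != 0.
  apply: contra_eq_neq (prim_expr_order pw) => ->.
  by rewrite expr0n gtn_eqF// eq_sym oner_eq0.
under eq_bigr => j _.
  rewrite big_distrlr /=.
  over.
rewrite exchange_big /= (big_ord_widen _ (fun k => c k * d k) nm) mulr_sumr.
rewrite [RHS]big_mkcond /=; apply: eq_bigr => l _.
rewrite exchange_big /=.
have term (k : 'I_n) : \sum_(j < M) c l * (w ^+ j) ^+ l * (d k * (w ^+ j)^-1 ^+ k)
    = if (l == k :> nat) then M%:R * (c l * d k) else 0.
  under eq_bigr => j _.
    rewrite (_ : _ * _ = c l * d k * (w ^+ l / w ^+ k) ^+ j); last first.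
      by rewrite expr_div_n -!exprM !(mulnC j) exprVn -exprM (mulnC j) mulrACA.
    over.
  rewrite -mulr_sumr; case: eqVneq => [->|lk].
    rewrite divff ?expf_neq0//; under eq_bigr do rewrite expr1n.
    by rewrite sumr_const card_ord mulrC.
  have v1 : w ^+ l / w ^+ k != 1.
    rewrite -(inj_eq (mulIf (expf_neq0 k w0))) mulfVK ?expf_neq0// mul1r.
    rewrite (eq_prim_root_expr pw) !modn_small//.
      exact: leq_trans (leq_trans nm mM).
    exact: leq_trans mM.
  have := subrX1 (w ^+ l / w ^+ k) M.
  rewrite expr_div_n -!exprM !(mulnC _ M) !exprM (prim_expr_order pw) !expr1n.
  rewrite divr1 subrr => /esym/eqP; rewrite mulf_eq0 subr_eq0 (negbTE v1) /=.
  by move=> /eqP ->; rewrite mulr0.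
under eq_bigr do rewrite term.
case: ifP => ln; last first.
  apply: big1 => k _; case: eqVneq => // lk.
  by move: ln; rewrite lk ltn_ord.
rewrite (bigD1 (Ordinal ln)) //= eqxx big1 ?addr0// => k kl.
rewrite ifN//; apply: contra kl => /eqP e; apply/eqP/val_inj.
by rewrite /= e.
Qed.

(** Dilating the variable from sqrt rho to rho multiplies the k-th coefficient by
    (sqrt rho)^k, and truncation to degree [N] is then convolution with
    D (w) = sum_(k <= N) (sqrt rho)^k w^k.  The weights [c] are the moduli of [D] at
    the roots of unity, divided by [M].  Their sum is estimated from Parseval's
    identity, which gives the mean of |D|^2. *)
Lemma partial_sum_kernel a (rho : R) N M : 0 <= rho < 1 -> (N < M)%N ->
  exists c : nat -> R, [/\ forall j, 0 <= c j,
    \sum_(j < M) c j <= (Num.sqrt (1 - rho))^-1 &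
    forall z, normc (partial_sum a N (rho%:C * z)) <= \sum_(j < M)
      c j * normc (partial_sum a M.-1
        ((Num.sqrt rho)%:C * z * cis (2 * pi / M%:R) ^+ j))].
Proof.
move=> /andP[rho0 rho1] NM.
have M0 : (0 < M)%N by exact: leq_ltn_trans NM.
set r := Num.sqrt rho; set w := cis _.
have pw : M.-primitive_root w by exact: cis_primitive_root.
have r0 : 0 <= r by rewrite sqrtr_ge0.
have rr : r * r = rho by rewrite -expr2 sqr_sqrtr.
have M0' : 0 < M%:R :> R by rewrite ltr0n.
pose D z := \sum_(k < N.+1) (r ^+ k)%:C * z ^+ k.
have wV j : (w ^+ j)^-1 = conjc (w ^+ j).
  have w1 : normc (w ^+ j) = 1 by rewrite normcX normc_cis expr1n.
  have := mulc_conj (w ^+ j); rewrite w1 expr1n => e.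
  have u : w ^+ j != 0.
    apply/eqP => w0; move: w1; rewrite w0 Normc.normc0 => /eqP.
    by rewrite eq_sym oner_eq0.
  by apply: (mulfI u); rewrite divff.
have DV j : D ((w ^+ j)^-1) = conjc (D (w ^+ j)).
  rewrite wV /D.
  transitivity (\sum_(k < N.+1) conjc ((r ^+ k)%:C * (w ^+ j) ^+ k)).
    apply: eq_bigr => k _.
    have -> x y : conjc (x * y) = conjc x * conjc y :> R[i] by exact: rmorphM.
    have -> : conjc ((w ^+ j) ^+ k) = conjc (w ^+ j) ^+ k by exact: rmorphXn.
    by rewrite conjc_real.
  by symmetry; exact: rmorph_sum.
exists (fun j => normc (D ((w ^+ j)^-1)) / M%:R); split.
- by move=> j; rewrite divr_ge0 ?normc_ge0 ?ltW.
- pose s := Num.sqrt (1 - rho).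
  have s0 : 0 < s by rewrite sqrtr_gt0 subr_gt0.
  have ss : s * s = 1 - rho by rewrite -expr2 sqr_sqrtr// subr_ge0 ltW.
  have parseval : \sum_(j < M) normc (D ((w ^+ j)^-1)) ^+ 2 =
      M%:R * \sum_(k < N.+1) rho ^+ k.
    apply: (@complexI R); rewrite rmorphM rmorph_sum /= rmorph_nat.
    under eq_bigr => j _ do rewrite -mulc_conj mulrC {1}DV conjcK.
    rewrite (@root_convolution _ M w
      (fun k => (r ^+ k)%:C) (fun k => (r ^+ k)%:C))//.
      by rewrite rmorph_sum /=; congr (_ * _); apply: eq_bigr => k _;
        rewrite -rmorphM -exprMn rr.
    by rewrite leqnn.
  have geo : \sum_(k < N.+1) rho ^+ k <= (s * s)^-1.
    rewrite -[leRHS]mul1r ler_pdivlMr ?mulr_gt0// ss.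
    have := subrX1 rho N.+1; have : 0 <= rho ^+ N.+1 by rewrite exprn_ge0.
    by rewrite mulrC; lra.
  rewrite -mulr_suml ler_pdivrMr//.
  apply: (@le_trans _ _ (\sum_(j < M)
     (s * normc (D ((w ^+ j)^-1)) ^+ 2 + s^-1) / 2)).
    (* Arithmetic-geometric inequality; the weight s balances the two terms. *)
    apply: ler_sum => j _; set x := normc _.
    have -> : (s * x ^+ 2 + s^-1) / 2 = x + (s * x - 1) ^+ 2 / (2 * s).
      by field; rewrite gt_eqF.
    by rewrite lerDl divr_ge0 ?sqr_ge0// mulr_ge0// ltW.
  rewrite -mulr_suml big_split /= -mulr_sumr parseval sumr_const card_ord.
  rewrite -(mulr_natr _ M).
  have : s * (M%:R * \sum_(k < N.+1) rho ^+ k) <= s^-1 * M%:R.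
    have -> : s^-1 * M%:R = s * (M%:R * (s * s)^-1) by field; rewrite gt_eqF.
    by rewrite !ler_wpM2l// ltW.
  lra.
- move=> z.
  have E : partial_sum a N (rho%:C * z) = \sum_(j < M)
     partial_sum a M.-1 (r%:C * z * w ^+ j) * (D ((w ^+ j)^-1) / M%:R).
    have := @root_convolution _ M w (fun l => a l * (r%:C * z) ^+ l)
      (fun k => (r ^+ k)%:C) N.+1 M pw.
    rewrite NM leqnn => /(_ isT) H.
    have -> : partial_sum a N (rho%:C * z) =
      \sum_(k < N.+1) a k * (r%:C * z) ^+ k * (r ^+ k)%:C.
      apply: eq_bigr => k _.
      by rewrite -rr rmorphM rmorphXn /= !exprMn; ring.
    have Mn0 : M%:R != 0 :> R[i] by rewrite pnatr_eq0 -lt0n.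
    apply: (mulfI Mn0); rewrite -H mulr_sumr; apply: eq_bigr => j _.
    rewrite [RHS]mulrCA [X in _ = _ * X]mulrCA divff// mulr1.
    congr (_ * _); rewrite /partial_sum prednK//.
    by apply: eq_bigr => l _; rewrite -(mulrA (a l)) -exprMn.
  rewrite E (le_trans (ler_normc_sum _ _ _))//; apply: ler_sum => j _.
  rewrite !Normc.normcM mulrC Normc.normcV.
  have -> : normc M%:R = M%:R.
    by rewrite -(rmorph_nat (real_complex R)) normcR ger0_norm// ltW.
  by [].
Qed.

End Roots.

(** * The weight 1 / sqrt (1 - |z|^2) is integrable over the disc *)

Section Weight.
Context {R : realType}.
Notation mu := (@lebesgue_measure R).
Notation TR := (measurableTypeR R).
Notation area := (@lebesgue_measure R \x @lebesgue_measure R)%E.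

(** x^2 / q, where q = sqrt (c - x^2), is the derivative of - x q up to the
    bounded term q.  The linear term 3 x makes the derivative at least
    1 + x^2 / q as soon as q <= 2. *)
Lemma is_derive_sqrt_profile (c x : R) : 0 < c - x ^+ 2 ->
  is_derive x 1 (fun t => 3 * t - t * Num.sqrt (c - t ^+ 2))
    (3 - Num.sqrt (c - x ^+ 2) + x ^+ 2 / Num.sqrt (c - x ^+ 2)).
Proof.
move=> cx.
have d1 : is_derive x 1 (fun t : R => c - t ^+ 2) (- (2 * x)).
  apply: is_derive_eq; rewrite /GRing.scale /=; ring.
have d2 := @is_derive1_comp _ Num.sqrt (fun t : R => c - t ^+ 2) x _ _
  (is_derive1_sqrt cx) d1.
have s0 : Num.sqrt (c - x ^+ 2) != 0 by rewrite gt_eqF// sqrtr_gt0.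
have -> : (fun t => 3 * t - t * Num.sqrt (c - t ^+ 2)) =
  (fun t : R => 3 * t) \- (id \* (Num.sqrt \o (fun t : R => c - t ^+ 2))) by [].
apply: is_derive_eq; rewrite /GRing.scale /=.
by field.
Qed.

Lemma integral_sqrt_profile (c s : R) : 0 < s -> s <= 1 ->
  s ^+ 2 < c ->
  (\int[mu]_(x in `[(- s)%R, s])
    (3 - Num.sqrt (c - x ^+ 2) + x ^+ 2 / Num.sqrt (c - x ^+ 2))%:E <= 6%:E)%E.
Proof.
move=> s0 s1 sc.
have pos x : x \in `[(- s), s] -> 0 < c - x ^+ 2.
  rewrite in_itv /= => /andP[x1 x2]; rewrite subr_gt0 (le_lt_trans _ sc)//.
  by rewrite -[leLHS]real_normK ?num_real// lerXn2r ?nnegrE// ?(ltW s0)// ler_norml x1.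
pose F t : R := 3 * t - t * Num.sqrt (c - t ^+ 2).
have cF x : x \in `[(- s), s] -> {for x, continuous F}.
  move=> /pos/is_derive_sqrt_profile d.
  by apply/differentiable_continuous/derivable1_diffP.
have ss : - s < s by lra.
rewrite (@continuous_FTC2 _ _ F)//.
- rewrite /F sqrrN -EFinB lee_fin.
  have := sqrtr_ge0 (c - s ^+ 2); set q := Num.sqrt _ => q0.
  have : 0 <= s * q by rewrite mulr_ge0// ltW.
  lra.
- apply: continuous_in_subspaceT => x; rewrite inE /= => /pos cx.
  have cq : (fun t : R => Num.sqrt (c - t ^+ 2)) @ x --> Num.sqrt (c - x ^+ 2).
    apply: (continuous_comp (f := fun t : R => c - t ^+ 2)); last exact: sqrt_continuous.
    apply: cvgB; first exact: cvg_cst.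
    exact: exprn_continuous.
  apply: cvgD; first by apply: cvgB => //; exact: cvg_cst.
  apply: cvgM; first exact: exprn_continuous.
  by apply: cvgV => //; rewrite gt_eqF// sqrtr_gt0.
- split.
  + move=> x xs; have /pos/is_derive_sqrt_profile := subset_itv_oo_cc xs.
    by move=> d; exact: ex_derive.
  + by apply: cvg_at_right_filter; apply: cF; rewrite in_itv /= lexx ltW.
  + by apply: cvg_at_left_filter; apply: cF; rewrite in_itv /= lexx andbT ltW.
- move=> x xs; have /pos/is_derive_sqrt_profile := subset_itv_oo_cc xs.
  by move=> d; rewrite derive1E derive_val.
Qed.

(** The inverse square root is a real power, also at 0, where both are 0, and on
    negative numbers once these are truncated to 0. *)
Lemma measurable_sqrtV d (T : measurableType d) (g : T -> R) :
  measurable_fun setT g -> measurable_fun setT (fun t => (Num.sqrt (g t))^-1).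
Proof.
move=> mg.
have -> : (fun t => (Num.sqrt (g t))^-1) =
    (@powR R ^~ (- 2^-1)) \o (fun t => Num.max (g t) 0).
  apply/funext => t /=; rewrite powRN powR12_sqrt ?le_max ?lexx ?orbT//.
  by congr (_^-1); case: (leP (g t) 0) => // g0; rewrite sqrtr0 ler0_sqrtr.
apply: measurableT_comp; first exact: measurable_powR.
by apply: measurable_maxr => //; exact: measurable_cst.
Qed.

Lemma measurable_cut d (T : measurableType d) (u g : T -> R) :
  measurable_fun setT u -> measurable_fun setT g ->
  measurable_fun setT (fun t => if u t < 1 then g t else 0).
Proof.
move=> mu mg; apply: measurable_fun_ifT => //.
by apply: measurable_fun_ltr => //; exact: measurable_cst.
Qed.

(** The parameter [e] > 0 keeps the integrand continuous on the closed slice, as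
    the fundamental theorem of calculus requires; the bound does not depend on
    it. *)
Lemma integral_disc_slice (e y : R) : 0 < e <= 1 ->
  (\int[mu]_x (if x ^+ 2 + y ^+ 2 < 1 then
     1 + x ^+ 2 / Num.sqrt (1 + e - (x ^+ 2 + y ^+ 2)) else 0)%R%:E <=
   (if `|y| <= 1 then 6 else 0)%R%:E)%E.
Proof.
move=> /andP[e0 e1].
have [y1|y1] := ltP (y ^+ 2) 1; last first.
  rewrite integral0_eq ?lee_fin; first by case: ifP.
  move=> x _; rewrite ifF//; apply/negbTE; rewrite -leNgt.
  by rewrite (le_trans y1)// lerDr sqr_ge0.
have y1' : `|y| <= 1.
  by rewrite -(@ler_pXn2r _ 2) ?nnegrE// real_normK ?num_real// expr1n ltW.
rewrite y1'.
pose s := Num.sqrt (1 - y ^+ 2).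
have s0 : 0 < s by rewrite sqrtr_gt0 subr_gt0.
have ss : s ^+ 2 = 1 - y ^+ 2 by rewrite sqr_sqrtr// subr_ge0 ltW.
have y0 := sqr_ge0 y.
have s1 : s <= 1 by rewrite -(@ler_pXn2r _ 2) ?nnegrE ?(ltW s0)// expr1n; lra.
have sc : s ^+ 2 < 1 + e - y ^+ 2 by rewrite ss; lra.
apply: le_trans (integral_sqrt_profile s0 s1 sc).
rewrite [leRHS]integral_mkcond.
have q2 x : Num.sqrt (1 + e - y ^+ 2 - x ^+ 2) <= 2.
  rewrite -[leRHS]ger0_norm// -sqrtr_sqr ler_wsqrtr//.
  by have := sqr_ge0 x; lra.
have mx2 : measurable_fun [set: TR] (fun x : R => x ^+ 2).
  exact: exprn_measurable.
have mc (k : R) : measurable_fun [set: TR] (fun x : R => k) by exact: measurable_cst.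
apply: ge0_le_integral => //.
- move=> x _; rewrite lee_fin; case: ifP => // _.
  by rewrite addr_ge0// divr_ge0 ?sqr_ge0 ?sqrtr_ge0.
- apply/measurable_EFinP; apply: measurable_cut.
    by apply: measurable_funD.
  apply: measurable_funD => //; apply: measurable_funM => //.
  apply: measurable_sqrtV; apply: measurable_funB => //.
  exact: measurable_funD.
- apply/(measurable_restrictT _ _).1 => //; apply: measurable_funTS.
  apply/measurable_EFinP; apply: measurable_funD.
    apply: measurable_funB => //.
    apply: (measurableT_comp (f := @Num.sqrt R)).
      by apply: continuous_measurable_fun; exact: sqrt_continuous.
    exact: measurable_funB.
  apply: measurable_funM => //; apply: measurable_sqrtV.
  exact: measurable_funB.
- move=> x _; rewrite /patch.
  have -> : 1 + e - (x ^+ 2 + y ^+ 2) = 1 + e - y ^+ 2 - x ^+ 2 by ring.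
  have := q2 x; set q := Num.sqrt _ => q2x.
  have t0 : 0 <= x ^+ 2 / q by rewrite divr_ge0 ?sqr_ge0 ?sqrtr_ge0.
  have [xd|xd] := ltP (x ^+ 2 + y ^+ 2) 1.
  + rewrite ifT; first by rewrite lee_fin; lra.
    rewrite mem_setE in_itv /= -ler_norml.
    rewrite -(@ler_pXn2r _ 2) ?nnegrE ?(ltW s0)// real_normK ?num_real// ss.
    by lra.
  + by case: ifP => // _; rewrite lee_fin; lra.
Qed.

Lemma measurable_sqnorm : measurable_fun [set: TR * TR]
  (fun p : TR * TR => p.1 ^+ 2 + p.2 ^+ 2 : R).
Proof.
have m1 : measurable_fun [set: TR * TR] (fun p => p.1 : R).
  exact: measurable_fst.
have m2 : measurable_fun [set: TR * TR] (fun p => p.2 : R).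
  exact: measurable_snd.
by apply: measurable_funD;
  [exact: (measurable_funX 2 m1)|exact: (measurable_funX 2 m2)].
Qed.

(** With q = sqrt (1 + e - |z|^2), 1 / q is at most x^2 / q + y^2 / q + 2, and
    the slice bound applies to each of the two quotients, in its own direction. *)
Lemma integral_disc_profile (e : R) : 0 < e <= 1 ->
  (\int[area]_p (if p.1 ^+ 2 + p.2 ^+ 2 < 1 then
     (Num.sqrt (1 + e - (p.1 ^+ 2 + p.2 ^+ 2)))^-1 else 0)%R%:E <= 24%:E)%E.
Proof.
move=> e01; have /andP[e0 e1] := e01.
have mn := measurable_sqnorm.
have mc (k : R) : measurable_fun [set: TR * TR] (fun=> k) by exact: measurable_cst.
have mq : measurable_fun [set: TR * TR]
    (fun p => (Num.sqrt (1 + e - (p.1 ^+ 2 + p.2 ^+ 2)))^-1 : R).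
  apply: measurable_sqrtV; apply: measurable_funB => //.
have mK (u : TR * TR -> R) : measurable_fun [set: TR * TR] u ->
  measurable_fun [set: TR * TR] (fun p => (if p.1 ^+ 2 + p.2 ^+ 2 < 1 then
     1 + u p ^+ 2 / Num.sqrt (1 + e - (p.1 ^+ 2 + p.2 ^+ 2)) else 0)%R%:E).
  move=> mu'; apply/measurable_EFinP/measurable_cut => //.
  apply: measurable_funD => //; apply: measurable_funM => //.
  exact: measurable_funX.
have K0 (u : TR * TR -> R) (p : TR * TR) :
  (0%:E <= (if p.1 ^+ 2 + p.2 ^+ 2 < 1 then
     1 + u p ^+ 2 / Num.sqrt (1 + e - (p.1 ^+ 2 + p.2 ^+ 2)) else 0)%R%:E)%E.
  rewrite lee_fin; case: ifP => // _.
  by rewrite addr_ge0// divr_ge0 ?sqr_ge0 ?sqrtr_ge0.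
have mI : @measurable_fun _ _ TR (\bar R) setT
    (fun y : R => (if `|y| <= 1 then 6 else 0 : R)%:E).
  apply/measurable_EFinP; apply: measurable_fun_ifT; try exact: measurable_cst.
  by apply: measurable_fun_ler; [exact: normr_measurable|exact: measurable_cst].
have I12 : (\int[mu]_y (if `|y| <= 1 then 6 else 0)%R%:E
   <= 12%:E)%E.
  have -> : (\int[mu]_y (if `|y| <= 1 then 6 else 0)%R%:E =
      \int[mu]_(y in `[(-1)%R, 1%R]) (cst 6%:E y))%E.
    rewrite [RHS]integral_mkcond; apply: eq_integral => y _.
    by rewrite /patch mem_setE in_itv /= -ler_norml; case: ifP.
  rewrite integral_cst//= lebesgue_measure_itv /= lte_fin.
  rewrite ifT; last by lra.
  by rewrite -EFinB -EFinM lee_fin; lra.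
have B1 : (\int[area]_p (if p.1 ^+ 2 + p.2 ^+ 2 < 1 then
     1 + p.1 ^+ 2 / Num.sqrt (1 + e - (p.1 ^+ 2 + p.2 ^+ 2)) else 0)%R%:E
   <= 12%:E)%E.
  have m1 := mK fst measurable_fst.
  rewrite fubini_tonelli2.
  2: exact: m1.
  2: by move=> p; exact: K0.
  apply: le_trans I12; apply: ge0_le_integral => //.
  - by move=> y _; apply: integral_ge0 => x _; exact: K0.
  - by apply: (measurable_fun_fubini_tonelli_G _ m1) => p; exact: K0.
  - by move=> y _; exact: integral_disc_slice.
have B2 : (\int[area]_p (if p.1 ^+ 2 + p.2 ^+ 2 < 1 then
     1 + p.2 ^+ 2 / Num.sqrt (1 + e - (p.1 ^+ 2 + p.2 ^+ 2)) else 0)%R%:E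
   <= 12%:E)%E.
  have m2 := mK snd measurable_snd.
  rewrite fubini_tonelli1.
  2: exact: m2.
  2: by move=> p; exact: K0.
  apply: le_trans I12; apply: ge0_le_integral => //.
  - by move=> y _; apply: integral_ge0 => x _; exact: K0.
  - by apply: (measurable_fun_fubini_tonelli_F _ m2) => p; exact: K0.
  - move=> x _; rewrite /fubini_F /=.
    by under eq_integral do rewrite addrC; exact: integral_disc_slice.
have -> : (24%:E = 12%:E + 12%:E :> \bar R)%E.
  by rewrite -EFinD; congr (_%:E); lra.
apply: le_trans (leeD B1 B2).
rewrite -ge0_integralD//;
  [|exact: (mK fst measurable_fst)|exact: (mK snd measurable_snd)].
apply: ge0_le_integral => //.
- by move=> p _; rewrite lee_fin; case: ifP => // _; rewrite invr_ge0 sqrtr_ge0.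
- by apply/measurable_EFinP/measurable_cut.
- apply: emeasurable_funD.
    exact: (mK fst measurable_fst).
  exact: (mK snd measurable_snd).
move=> p _; rewrite -EFinD lee_fin; case: ifP => [pU|_]; last by rewrite addr0.
set n := p.1 ^+ 2 + p.2 ^+ 2 in pU *.
have q0 : 0 < Num.sqrt (1 + e - n) by rewrite sqrtr_gt0; lra.
have qq : Num.sqrt (1 + e - n) ^+ 2 = 1 + e - n by
  rewrite sqr_sqrtr//; move: pU; lra.
have n0 : 0 <= n by rewrite addr_ge0 ?sqr_ge0.
set q := Num.sqrt _ in q0 qq *.
have q2 : q <= 2 by rewrite -(@ler_pXn2r _ 2) ?nnegrE ?(ltW q0)//; lra.
have -> : 1 + p.1 ^+ 2 / q + (1 + p.2 ^+ 2 / q) = 2 + n / q by rewrite /n; ring.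
rewrite [leLHS](_ : q^-1 = q + (1 - q ^+ 2) / q); last by field; rewrite gt_eqF.
apply: lerD => //; apply: ler_wpM2r; first by rewrite invr_ge0 ltW.
by rewrite qq; lra.
Qed.

(** Fatou's lemma as e = 1 / (n + 1) tends to 0. *)
Lemma integral_disc_weight :
  (\int[area]_p (if p.1 ^+ 2 + p.2 ^+ 2 < 1 then
     (Num.sqrt (1 - (p.1 ^+ 2 + p.2 ^+ 2)))^-1 else 0)%R%:E <= (24 : R)%:E)%E.
Proof.
pose K (n : nat) (p : TR * TR) : \bar R := (if p.1 ^+ 2 + p.2 ^+ 2 < 1 then
     (Num.sqrt (1 + n.+1%:R^-1 - (p.1 ^+ 2 + p.2 ^+ 2)))^-1 else 0)%R%:E.
have mn := measurable_sqnorm.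
have mK n : measurable_fun [set: TR * TR] (K n).
  apply/measurable_EFinP/measurable_cut => //; apply: measurable_sqrtV.
  by apply: measurable_funB => //; exact: measurable_cst.
have K0 n p : (0 <= K n p)%E.
  by rewrite lee_fin; case: ifP => // _; rewrite invr_ge0 sqrtr_ge0.
have Kcvg p : K ^~ p @ \oo --> (if p.1 ^+ 2 + p.2 ^+ 2 < 1 then
     (Num.sqrt (1 - (p.1 ^+ 2 + p.2 ^+ 2)))^-1 else 0)%R%:E.
  rewrite /K; case: ifP => pU; last exact: cvg_cst.
  apply: cvg_EFin; first by near=> n.
  apply: cvgV; first by rewrite gt_eqF// sqrtr_gt0 subr_gt0.
  apply: continuous_cvg; first exact: sqrt_continuous.
  apply: cvgB; last exact: cvg_cst.
  rewrite -[X in _ --> X]addr0; apply: cvgD; first exact: cvg_cst.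
  exact: cvg_harmonic.
have := @fatou _ _ _ area setT measurableT K mK (fun n p _ => K0 n p).
under eq_integral => p _.
  rewrite is_cvg_limn_einfE; last by apply/cvg_ex; eexists; exact: Kcvg.
  rewrite (cvg_lim _ (Kcvg p))//.
  over.
move=> /le_trans; apply.
rewrite limn_einf_lim.
apply: lime_le; first exact: is_cvg_einfs.
near=> n; apply: (@le_trans _ _ (\int[area]_p K n p)%E).
  by apply: ereal_inf_lbound; exists n => /=.
by apply: integral_disc_profile; rewrite invr_gt0 ltr0n invf_le1// ler1n.
Unshelve. all: by end_near. Qed.

End Weight.

(** * Circle integrals of a function in the Hardy space and of its partial sums *)

Section Measurability.
Context {R : realType} d (T : measurableType d).
Local Notation normc := (@Normc.normc R).
Implicit Types (u v : T -> R[i]) (a : nat -> R[i]).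

(** Borel measurability into the plane, in coordinates. *)
Definition cmeasurable u :=
  measurable_fun setT (fun t => complex.Re (u t)) /\
  measurable_fun setT (fun t => complex.Im (u t)).

Lemma cmeasurable_cst z : cmeasurable (fun=> z).
Proof. by split; exact: measurable_cst. Qed.

Lemma cmeasurableD u v :
  cmeasurable u -> cmeasurable v -> cmeasurable (fun t => u t + v t).
Proof.
move=> [u1 u2] [v1 v2]; split.
- have -> : (fun t => complex.Re (u t + v t)) =
      (fun t => complex.Re (u t)) \+ (fun t => complex.Re (v t)).
    by apply/funext => t /=; case: (u t) => ? ?; case: (v t).
  exact: measurable_funD.
- have -> : (fun t => complex.Im (u t + v t)) =
      (fun t => complex.Im (u t)) \+ (fun t => complex.Im (v t)).
    by apply/funext => t /=; case: (u t) => ? ?; case: (v t).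
  exact: measurable_funD.
Qed.

Lemma cmeasurableM u v :
  cmeasurable u -> cmeasurable v -> cmeasurable (fun t => u t * v t).
Proof.
move=> [u1 u2] [v1 v2]; split.
- have -> : (fun t => complex.Re (u t * v t)) =
      ((fun t => complex.Re (u t)) \* (fun t => complex.Re (v t))) \-
      ((fun t => complex.Im (u t)) \* (fun t => complex.Im (v t))).
    by apply/funext => t /=; case: (u t) => ? ?; case: (v t).
  by apply: measurable_funB; exact: measurable_funM.
- have -> : (fun t => complex.Im (u t * v t)) =
      ((fun t => complex.Re (u t)) \* (fun t => complex.Im (v t))) \+
      ((fun t => complex.Im (u t)) \* (fun t => complex.Re (v t))).
    by apply/funext => t /=; case: (u t) => ? ?; case: (v t).
  by apply: measurable_funD; exact: measurable_funM.
Qed.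

Lemma cmeasurableX u n : cmeasurable u -> cmeasurable (fun t => u t ^+ n).
Proof.
move=> mu; elim: n => [|n IH]; first exact: cmeasurable_cst.
by under eq_fun do rewrite exprS; exact: cmeasurableM.
Qed.

Lemma cmeasurable_partial_sum a N u :
  cmeasurable u -> cmeasurable (fun t => partial_sum a N (u t)).
Proof.
move=> mu.
have term k : cmeasurable (fun t => a k * u t ^+ k).
  by apply: cmeasurableM; [exact: cmeasurable_cst|exact: cmeasurableX].
elim: N => [|N IH].
  by under eq_fun do rewrite /partial_sum big_ord1; exact: term.
by under eq_fun do rewrite partial_sumS; exact: cmeasurableD.
Qed.

Lemma measurable_normc u :
  cmeasurable u -> measurable_fun setT (fun t => normc (u t)).
Proof.
move=> [u1 u2].
have -> : (fun t => normc (u t)) = (@Num.sqrt R) \o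
    (fun t => complex.Re (u t) ^+ 2 + complex.Im (u t) ^+ 2).
  by apply/funext => t /=; case: (u t).
apply: measurableT_comp.
  by apply: continuous_measurable_fun; exact: sqrt_continuous.
by apply: measurable_funD; exact: measurable_funX.
Qed.

(** A power series is a pointwise limit of polynomials. *)
Lemma measurable_normc_limit a (f : R[i] -> R[i]) u v :
  (forall z, unit_disc z ->
     (partial_sum a n z : R[i]^o) @[n --> \oo] --> (f z : R[i]^o)) ->
  cmeasurable u -> cmeasurable v -> (forall t, unit_disc (u t)) ->
  measurable_fun setT (fun t => normc (v t - f (u t))).
Proof.
move=> af mu mv uU.
apply: (measurable_fun_cvg (h := fun n t => normc (v t - partial_sum a n (u t)))).
  move=> n; apply: measurable_normc.
  have -> : (fun t => v t - partial_sum a n (u t)) =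
      (fun t => v t + (-1) * partial_sum a n (u t)).
    by apply/funext => t; rewrite mulN1r.
  apply: cmeasurableD => //; apply: cmeasurableM; first exact: cmeasurable_cst.
  exact: cmeasurable_partial_sum.
move=> t _; have /cvg_normcB/cvgrPdist_lt ul := af _ (uU t).
apply/cvgrPdist_lt => e e0; apply: filterS (ul _ e0) => n.
rewrite sub0r normrN ger0_norm ?normc_ge0//; apply: le_lt_trans.
rewrite ler_norml; apply/andP; split.
- rewrite lerNl opprB lerBlDr.
  have -> : v t - partial_sum a n (u t) =
    - (partial_sum a n (u t) - f (u t)) + (v t - f (u t)) by ring.
  by rewrite (le_trans (ler_normcD _ _))// normcNE.
- rewrite lerBlDr.
  have -> : v t - f (u t) = (partial_sum a n (u t) - f (u t)) +
    (v t - partial_sum a n (u t)) by ring.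
  exact: ler_normcD.
Qed.

End Measurability.

Section Circle.
Context {R : realType}.
Notation mu := (@lebesgue_measure R).
Notation TR := (measurableTypeR R).
Local Notation normc := (@Normc.normc R).
Variables (f : R[i] -> R[i]) (a : nat -> R[i]).
Hypothesis af : forall z : R[i], unit_disc z ->
  (partial_sum a N z : R[i]^o) @[N --> \oo] --> (f z : R[i]^o).

Lemma unit_disc_circle (rho t : R) : 0 <= rho < 1 -> unit_disc (rho%:C * cis t).
Proof.
move=> /andP[r0 r1].
by rewrite /unit_disc /mkset Normc.normcM normcR normc_cis mulr1 ger0_norm.
Qed.

Lemma cmeasurable_circle (rho : R) :
  cmeasurable (fun t : TR => rho%:C * cis (t : R)).
Proof.
apply: cmeasurableM; first exact: cmeasurable_cst.
split=> /=; apply: continuous_measurable_fun.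
  exact: continuous_cos.
exact: continuous_sin.
Qed.

Lemma measurable_circle_f (rho : R) : 0 <= rho < 1 ->
  measurable_fun [set: TR] (fun t : R => (normc (f (rho%:C * cis t)))%:E).
Proof.
move=> r01; apply/measurable_EFinP.
have := measurable_normc_limit af (cmeasurable_circle rho)
  (cmeasurable_cst _ 0) (fun t => unit_disc_circle t r01).
by under eq_fun do rewrite sub0r normcNE.
Qed.

Lemma measurable_circle_sum (rho : R) N :
  measurable_fun [set: TR]
    (fun t : R => (normc (partial_sum a N (rho%:C * cis t)))%:E).
Proof.
apply/measurable_EFinP/measurable_normc/cmeasurable_partial_sum.
exact: cmeasurable_circle.
Qed.

Lemma measurable_circle_diff (rho : R) N : 0 <= rho < 1 ->
  measurable_fun [set: TR]
    (fun t : R =>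
      (normc (partial_sum a N (rho%:C * cis t) - f (rho%:C * cis t)))%:E).
Proof.
move=> r01; apply/measurable_EFinP.
apply: (measurable_normc_limit af (cmeasurable_circle rho) _
  (fun t => unit_disc_circle t r01)).
by apply: cmeasurable_partial_sum; exact: cmeasurable_circle.
Qed.

Lemma twopi_gt0 : 0 < 2 * pi :> R.
Proof. by rewrite mulr_gt0// pi_gt0. Qed.

Lemma hardy_circle : hardyH1 f -> exists2 C : R, 0 <= C &
  forall rho : R, 0 <= rho < 1 ->
   (\int[mu]_(t in `[0%R, (2 * pi)%R])
     (normc (f (rho%:C * cis t)))%:E <= C%:E)%E.
Proof.
move=> [_ hf].
have p0 := twopi_gt0.
pose I rho := (\int[mu]_(t in `[0%R, (2 * pi)%R])
  (normc (f (rho%:C * cis t)))%:E)%E.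
have I0 rho : (0 <= I rho)%E.
  by apply: integral_ge0 => t _; rewrite lee_fin normc_ge0.
have ub rho : 0 <= rho < 1 -> (((2 * pi)^-1)%:E * I rho <= H1norm f)%E.
  by move=> r01; apply: ereal_sup_ubound; exists rho => //=; rewrite in_itv.
have H0 : (0 <= H1norm f)%E.
  apply: le_trans (ub 0 _); last by rewrite lexx ltr01.
  by rewrite mule_ge0// lee_fin invr_ge0 ltW.
have Hfin : H1norm f \is a fin_num by rewrite ge0_fin_numE.
exists (2 * pi * fine (H1norm f)).
  by rewrite mulr_ge0 ?fine_ge0// ltW.
move=> rho r01; rewrite EFinM fineK//.
rewrite -[leLHS]mul1e.
have -> : (1 = (2 * pi)%:E * ((2 * pi)^-1)%:E :> \bar R)%E.
  by rewrite -EFinM divff// gt_eqF.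
rewrite -muleA lee_pmul2l//; exact: ub.
Qed.

(** [partial_sum_kernel] for large [M], with [S_(M-1)] replaced by [f] at the cost
    of a geometrically small error; each rotated copy of [f] has the same circle
    integral. *)
Lemma partial_sum_circle (C rho : R) N : 0 <= C ->
  (forall r : R, 0 <= r < 1 ->
   (\int[mu]_(t in `[0%R, (2 * pi)%R])
     (normc (f (r%:C * cis t)))%:E <= C%:E)%E) ->
  0 <= rho < 1 ->
  (\int[mu]_(t in `[0%R, (2 * pi)%R])
    (normc (partial_sum a N (rho%:C * cis t)))%:E <= (C / Num.sqrt (1 - rho))%:E)%E.
Proof.
move=> C0 fC r01; have /andP[r0 r1] := r01.
have p0 := twopi_gt0.
set r := Num.sqrt rho.
have rr : 0 <= r < 1.
  by rewrite sqrtr_ge0 -sqrtr1 ltr_sqrt.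
have [B [q [B0 /andP[q0 q1] err]]] := partial_sum_error af rr.
set k := (Num.sqrt (1 - rho))^-1.
have k0 : 0 <= k by rewrite invr_ge0 sqrtr_ge0.
have main M : (N < M)%N ->
  (\int[mu]_(t in `[0%R, (2 * pi)%R])
    (normc (partial_sum a N (rho%:C * cis t)))%:E <=
      ((C + 2 * pi * (B * q ^+ M.-1)) * k)%:E)%E.
  move=> NM.
  have [c [c0 ck cP]] := partial_sum_kernel a r01 NM.
  pose h (j : nat) (t : R) : \bar R :=
    (normc (f (r%:C * cis (t + 2 * pi / M%:R *+ j))) + B * q ^+ M.-1)%:E.
  have mh0 j : measurable_fun [set: TR]
      (fun t : R => (normc (f (r%:C * cis (t + 2 * pi / M%:R *+ j))))%:E).
    apply: (measurableT_comp (measurable_circle_f rr)).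
    exact: measurable_shift.
  have mh j : measurable_fun [set: TR] (h j).
    apply/measurable_EFinP; apply: measurable_funD.
      by have /measurable_EFinP := mh0 j.
    exact: measurable_cst.
  have h0 j t : (0 <= h j t)%E.
    by rewrite lee_fin addr_ge0 ?normc_ge0// mulr_ge0// exprn_ge0.
  have hj (j : 'I_M) : (\int[mu]_(t in `[0%R, (2 * pi)%R]) h j t <=
      (C + 2 * pi * (B * q ^+ M.-1))%:E)%E.
    rewrite /h; under eq_integral do rewrite EFinD.
    rewrite ge0_integralD//=; first last.
    - by move=> t _; rewrite lee_fin mulr_ge0// exprn_ge0.
    - exact: measurable_funTS.
    - by move=> t _; rewrite lee_fin normc_ge0.
    rewrite EFinD; apply: leeD.
      rewrite (periodic_integral_shift
        (g := fun t : R => (normc (f (r%:C * cis t)))%:E))//.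
      - exact: fC.
      - by move=> t; rewrite cis_2pi.
      - exact: measurable_circle_f.
      - by move=> t; rewrite lee_fin normc_ge0.
      have M0 : 0 < M%:R :> R by rewrite ltr0n (leq_ltn_trans _ NM).
      rewrite ger0_norm ?mulrn_wge0 ?divr_ge0 ?(ltW p0) ?(ltW M0)//.
      rewrite -(mulr_natr (2 * pi / M%:R)) mulrAC ler_pdivrMr// ler_pM2l//.
      by rewrite ler_nat ltnW.
    have -> : (fun t : R => (B * q ^+ M.-1)%:E) = cst (B * q ^+ M.-1)%:E by [].
    rewrite integral_cst//= lebesgue_measure_itv /= lte_fin p0 -EFinB subr0.
    by rewrite -EFinM mulrC.
  apply: (@le_trans _ _ (\int[mu]_(t in `[0%R, (2 * pi)%R])
     (\sum_(j < M) (c j)%:E * h j t))%E).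
    apply: ge0_le_integral => //.
    - by move=> t _; rewrite lee_fin normc_ge0.
    - by apply: measurable_funTS; exact: measurable_circle_sum.
    - apply: measurable_funTS; apply: emeasurable_sum => j.
      exact: measurable_funeM.
    - move=> t _.
      under eq_bigr do rewrite -EFinM.
      rewrite sumEFin lee_fin (le_trans (cP _))//; apply: ler_sum => j _.
      rewrite ler_wpM2l//.
      rewrite -mulrA -cisMn -cisD.
      set z := _ * cis _.
      have zr : normc z <= r.
        by rewrite /z Normc.normcM normc_cis mulr1 normcR ger0_norm// sqrtr_ge0.
      have -> : partial_sum a M.-1 z = f z + (partial_sum a M.-1 z - f z) by ring.
      by rewrite (le_trans (ler_normcD _ _))// lerD2l err.
  rewrite ge0_integral_sum//; first last.
  - by move=> j t _; rewrite mule_ge0// lee_fin.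
  - by move=> j; apply: measurable_funTS; exact: measurable_funeM.
  apply: (@le_trans _ _ (\sum_(j < M)
      (c j)%:E * (C + 2 * pi * (B * q ^+ M.-1))%:E)%E).
    apply: lee_sum => j _; rewrite ge0_integralZl_EFin//; last exact: measurable_funTS.
    by apply: lee_wpmul2l => //; rewrite lee_fin.
  under eq_bigr do rewrite -EFinM.
  rewrite sumEFin lee_fin -mulr_suml mulrC ler_wpM2l//.
  by rewrite addr_ge0// !mulr_ge0 ?exprn_ge0 ?pi_ge0.
(* [M] tends to infinity in [main]. *)
apply/lee_addgt0Pr => e e0.
have : (2 * pi * B * k) * q ^+ n @[n --> \oo] --> (2 * pi * B * k) * 0.
  by apply: cvgMr; apply: cvg_expr; rewrite ger0_norm.
rewrite mulr0 => /cvgrPdist_lt/(_ _ e0)[m _ mP].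
have := mP (N + m)%N (leq_addl _ _); rewrite /= sub0r normrN => qe.
apply: (le_trans (main (N + m).+1 _)); first by rewrite ltnS leq_addr.
rewrite -EFinD lee_fin mulrDl lerD2l /=.
apply: le_trans (ltW qe); rewrite ger0_norm; first by rewrite !mulrA mulrAC.
by rewrite !mulr_ge0 ?exprn_ge0 ?pi_ge0.
Qed.

End Circle.

(** * Averaging over rotations and dominated convergence *)

Section Rotation.
Context {R : realType}.
Notation mu := (@lebesgue_measure R).
Notation TR := (measurableTypeR R).
Notation area := (@lebesgue_measure R \x @lebesgue_measure R)%E.

Lemma area_sigma_finite : sigma_finite setT area.
Proof.
exists (fun n => `[- n%:R, n%:R] `*` `[- n%:R, n%:R]).
  apply/seteqP; split=> // -[x y] _.
  have xy0 : 0 <= `|x : R| + `|y : R| by rewrite addr_ge0.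
  have b := archi_boundP xy0.
  exists (Num.bound (`|x : R| + `|y : R|)) => //=; rewrite !in_itv /= -!ler_norml.
  by split; apply: le_trans (ltW b); rewrite ?lerDl ?lerDr.
move=> n; split.
  exact: measurableX.
rewrite product_measure1E// /= lebesgue_measure_itv /=.
by case: ifP => _; rewrite -?EFinB -?EFinM ?mule0 ltry.
Qed.

Definition rotate (t : R) (p : R * R) : R * R :=
  (cos t * p.1 - sin t * p.2, sin t * p.1 + cos t * p.2).

Lemma rotateE t p :
  (rotate t p).1 +i* (rotate t p).2 = cis t * (p.1 +i* p.2).
Proof. by rewrite /rotate /cis /=; congr (_ +i* _); rewrite addrC. Qed.

Lemma measurable_rotate :
  measurable_fun [set: TR * (TR * TR)]
    (fun q : TR * (TR * TR) => rotate q.1 q.2 : TR * TR).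
Proof.
have m1 : measurable_fun [set: TR * (TR * TR)] (fun q => q.2.1 : R).
  by apply: (measurableT_comp (f := fst));
    [exact: measurable_fst|exact: measurable_snd].
have m2 : measurable_fun [set: TR * (TR * TR)] (fun q => q.2.2 : R).
  by apply: (measurableT_comp (f := snd)); exact: measurable_snd.
have mc : measurable_fun [set: TR * (TR * TR)] (fun q => cos (q.1 : R)).
  apply: (measurableT_comp (f := @cos R)); last exact: measurable_fst.
  by apply: continuous_measurable_fun; exact: continuous_cos.
have ms : measurable_fun [set: TR * (TR * TR)] (fun q => sin (q.1 : R)).
  apply: (measurableT_comp (f := @sin R)); last exact: measurable_fst.
  by apply: continuous_measurable_fun; exact: continuous_sin.
apply: (@measurable_fun_pair _ _ _ _ TR TR).
- by apply: measurable_funB; exact: measurable_funM.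
- by apply: measurable_funD; exact: measurable_funM.
Qed.

(** Each rotated copy of [F] has the same integral; average over the angle and
    exchange the integrals. *)
Lemma integral_rotation_mean (F : TR * TR -> \bar R) :
  measurable_fun setT F -> (forall p, 0 <= F p)%E ->
  measurable_fun [set: TR * TR]
    (fun p => \int[mu]_(t in `[0%R, (2 * pi)%R]) F (rotate t p))%E /\
  ((2 * pi)%:E * \int[area]_p F p =
   \int[area]_p \int[mu]_(t in `[0%R, (2 * pi)%R]) F (rotate t p))%E.
Proof.
move=> mF F0.
have p0 := @twopi_gt0 R.
(* Tonelli's theorem is about functions on the whole product space. *)
pose K (q : TR * (TR * TR)) : \bar R :=
  if q.1 \in `[0, 2 * pi] then F (rotate q.1 q.2) else 0%E.
have mK : measurable_fun setT K.
  apply: measurable_fun_ifT; last exact: measurable_cst.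
    apply: measurable_and; apply: measurable_fun_ler;
      do ?[exact: measurable_cst|exact: measurable_fst].
  by apply: (measurableT_comp mF); exact: measurable_rotate.
have K0 q : (0 <= K q)%E by rewrite /K; case: ifP.
have inner p : (\int[mu]_(t in `[0%R, (2 * pi)%R]) F (rotate t p) =
    \int[mu]_t K (t, p))%E.
  rewrite integral_mkcond; apply: eq_integral => t _.
  by rewrite /patch mem_setE.
under eq_fun do rewrite inner.
split.
  exact: (measurable_fun_fubini_tonelli_G (m1 := mu) _ mK K0).
pose areaS : {sigma_finite_measure set (TR * TR)%type -> \bar R} :=
  HB.pack area (Measure_isSigmaFinite.Build _ _ _ area area_sigma_finite).
rewrite -(fubini_tonelli (m1 := mu) (m2 := areaS) K mK K0).
transitivity (\int[mu]_(t in `[0%R, (2 * pi)%R]) (cst (\int[area]_p F p) t))%E.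
  by rewrite integral_cst//= lebesgue_measure_itv /= lte_fin p0 -EFinB subr0 muleC.
rewrite integral_mkcond; apply: eq_integral => t _.
rewrite /patch mem_setE /K /=; case: ifP => _; last by rewrite integral0.
rewrite -(@integral_rotation _ F (cos t) (sin t))//; exact: cos2Dsin2.
Qed.

End Rotation.

Section Main.
Context {R : realType}.
Notation mu := (@lebesgue_measure R).
Notation TR := (measurableTypeR R).
Notation area := (@lebesgue_measure R \x @lebesgue_measure R)%E.
Local Notation normc := (@Normc.normc R).
Variables (f : R[i] -> R[i]) (a : nat -> R[i]).
Hypothesis af : forall z : R[i], unit_disc z ->
  (partial_sum a N z : R[i]^o) @[N --> \oo] --> (f z : R[i]^o).

(** Extended by 0 outside the disc, so that it can be rotated as a function on the
    whole plane. *)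
Definition disc_error N (p : R * R) : \bar R :=
  (if p.1 ^+ 2 + p.2 ^+ 2 < 1 then
     normc (partial_sum a N (p.1 +i* p.2) - f (p.1 +i* p.2)) else 0)%:E.

Lemma unit_discE (p : R * R) :
  unit_disc (p.1 +i* p.2) <-> p.1 ^+ 2 + p.2 ^+ 2 < 1.
Proof.
rewrite /unit_disc /mkset /= -[X in _ < X]sqrtr1.
by rewrite ltr_sqrt.
Qed.

Lemma disc_error_ge0 N p : (0 <= disc_error N p)%E.
Proof. by rewrite lee_fin; case: ifP => // _; exact: normc_ge0. Qed.

Lemma measurable_disc_error N : measurable_fun [set: TR * TR] (disc_error N).
Proof.
apply/measurable_EFinP.
(* The limit defining [f] exists only on the disc: points outside are moved to
   the origin. *)
pose phi (p : TR * TR) : R[i] :=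
  (if p.1 ^+ 2 + p.2 ^+ 2 < 1 then p.1 else 0) +i*
  (if p.1 ^+ 2 + p.2 ^+ 2 < 1 then p.2 else 0).
have mphi : cmeasurable phi.
  split; apply: measurable_cut; do ?exact: measurable_sqnorm.
    exact: measurable_fst.
  exact: measurable_snd.
have phiU p : unit_disc (phi p).
  apply/(unit_discE (_, _)) => /=; rewrite /phi; case: ifP => //=.
  by rewrite expr0n addr0 ltr01.
have -> : (fun p : TR * TR => if p.1 ^+ 2 + p.2 ^+ 2 < 1 then
     normc (partial_sum a N (p.1 +i* p.2) - f (p.1 +i* p.2)) else 0) =
   (fun p : TR * TR => if p.1 ^+ 2 + p.2 ^+ 2 < 1 then
     normc (partial_sum a N (phi p) - f (phi p)) else 0).
  by apply/funext => p; rewrite /phi; case: ifP.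
apply: measurable_cut; first exact: measurable_sqnorm.
by apply: (measurable_normc_limit af) => //; exact: cmeasurable_partial_sum.
Qed.

Lemma A1norm_disc_error N :
  A1norm (fun z => partial_sum a N z - f z) = (\int[area]_p disc_error N p)%E.
Proof.
rewrite /A1norm integral_mkcond; apply: eq_integral => p _.
rewrite /patch /disc_error; case: ifPn => pU; case: ifPn => pn //.
- by move: pU; rewrite inE => /unit_discE; rewrite (negbTE pn).
- by move: pU; rewrite notin_setE; case; exact/unit_discE.
Qed.

(** 2 pi times the mean of the error over the circle through [p]. *)
Definition circle_error N (p : R * R) : \bar R :=
  (\int[mu]_(t in `[0%R, (2 * pi)%R]) disc_error N (rotate t p))%E.

Lemma rotate_sqnorm t (p : R * R) :
  (rotate t p).1 ^+ 2 + (rotate t p).2 ^+ 2 = p.1 ^+ 2 + p.2 ^+ 2.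
Proof.
have : cos t ^+ 2 = 1 - sin t ^+ 2 by rewrite cos2sin2.
by rewrite /rotate /=; move: (cos t) (sin t) => c s e; ring: e.
Qed.

Lemma circle_error_out N (p : R * R) :
  ~~ (p.1 ^+ 2 + p.2 ^+ 2 < 1) -> circle_error N p = 0%E.
Proof.
move=> /negbTE pn; apply: integral0_eq => t _.
by rewrite /disc_error rotate_sqnorm pn.
Qed.

(** The starting point on the circle does not matter, by periodicity. *)
Lemma circle_errorE N (p : R * R) : p.1 ^+ 2 + p.2 ^+ 2 < 1 ->
  let rho := Num.sqrt (p.1 ^+ 2 + p.2 ^+ 2) in
  circle_error N p = (\int[mu]_(t in `[0%R, (2 * pi)%R])
    (normc (partial_sum a N (rho%:C * cis t) - f (rho%:C * cis t)))%:E)%E.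
Proof.
move=> pU rho.
have r01 : 0 <= rho < 1 by rewrite sqrtr_ge0 -sqrtr1 ltr_sqrt.
have [s sp pE] := polar_form (p.1 +i* p.2).
rewrite -(periodic_integral_shift (T := 2 * pi) (c := s)
  (g := fun t : R =>
    (normc (partial_sum a N (rho%:C * cis t) - f (rho%:C * cis t)))%:E)).
- apply: eq_integral => t _.
  rewrite /disc_error rotate_sqnorm pU rotateE pE cisD.
  by rewrite (mulrC (cis t)) -mulrA (mulrC (cis s)).
- exact: twopi_gt0.
- by move=> t; rewrite cis_2pi.
- exact: measurable_circle_diff.
- by move=> t; rewrite lee_fin normc_ge0.
- exact: sp.
Qed.

Lemma circle_error_cvg p : circle_error N p @[N --> \oo] --> 0%E.
Proof.
have [pU|pn] := boolP (p.1 ^+ 2 + p.2 ^+ 2 < 1); last first.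
  by under eq_fun do rewrite circle_error_out//; exact: cvg_cst.
have p0 := @twopi_gt0 R.
pose rho := Num.sqrt (p.1 ^+ 2 + p.2 ^+ 2).
have r01 : 0 <= rho < 1 by rewrite sqrtr_ge0 -sqrtr1 ltr_sqrt.
have [B [q [B0 /andP[q0 q1] err]]] := partial_sum_error af r01.
apply: (@squeeze_cvge _ _ _ _ (fun=> 0%E) _ (fun n => (2 * pi * B * q ^+ n)%:E)).
- apply: nearW => n; rewrite circle_errorE//; apply/andP; split.
    by apply: integral_ge0 => t _; rewrite lee_fin normc_ge0.
  apply: (@le_trans _ _
      (\int[mu]_(t in `[0%R, (2 * pi)%R]) cst (B * q ^+ n)%:E t)%E).
    apply: ge0_le_integral => //.
    + by move=> t _; rewrite lee_fin normc_ge0.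
    + by apply: measurable_funTS; exact: measurable_circle_diff.
    + move=> t _; rewrite lee_fin; apply: err.
      by rewrite Normc.normcM normc_cis mulr1 normcR ger0_norm//; case/andP: r01.
  rewrite integral_cst//= lebesgue_measure_itv /= lte_fin p0 -EFinB subr0.
  by rewrite -EFinM lee_fin mulrC !mulrA.
- exact: cvg_cst.
- apply: cvg_EFin; first by near=> n.
  rewrite -[X in _ --> X](mulr0 (2 * pi * B)).
  by apply: cvgMr; apply: cvg_expr; rewrite ger0_norm.
Unshelve. all: by end_near. Qed.

(** The bounds for the circle integrals of [S_N] and of [f] add up to
    C / sqrt (1 - rho) + C, and 1 - rho^2 <= 2 (1 - rho). *)
Lemma circle_error_le (C : R) N p : 0 <= C ->
  (forall r : R, 0 <= r < 1 ->
   (\int[mu]_(t in `[0%R, (2 * pi)%R])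
     (normc (f (r%:C * cis t)))%:E <= C%:E)%E) ->
  (circle_error N p <= (4 * C)%:E * (if p.1 ^+ 2 + p.2 ^+ 2 < 1 then
     (Num.sqrt (1 - (p.1 ^+ 2 + p.2 ^+ 2)))^-1 else 0)%R%:E)%E.
Proof.
move=> C0 fC.
have [pU|pn] := boolP (p.1 ^+ 2 + p.2 ^+ 2 < 1); last first.
  by rewrite circle_error_out// mule0.
rewrite circle_errorE//; set rho := Num.sqrt (p.1 ^+ 2 + p.2 ^+ 2).
have n0 : 0 <= p.1 ^+ 2 + p.2 ^+ 2 by rewrite addr_ge0 ?sqr_ge0.
have r01 : 0 <= rho < 1 by rewrite sqrtr_ge0 -sqrtr1 ltr_sqrt.
have /andP[r0 r1] := r01.
have -> : p.1 ^+ 2 + p.2 ^+ 2 = rho ^+ 2 by rewrite sqr_sqrtr.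
set s := Num.sqrt (1 - rho).
have s0 : 0 < s by rewrite sqrtr_gt0 subr_gt0.
have s1 : s <= 1 by rewrite -sqrtr1 ler_wsqrtr//; lra.
apply: (@le_trans _ _ ((C / s)%:E + C%:E)%E).
  apply: le_trans (leeD (partial_sum_circle af N C0 fC r01) (fC _ r01)).
  rewrite -ge0_integralD//; first last.
  - by apply: measurable_funTS; exact: (measurable_circle_f af r01).
  - by move=> t _; rewrite lee_fin normc_ge0.
  - by apply: measurable_funTS; exact: measurable_circle_sum.
  - by move=> t _; rewrite lee_fin normc_ge0.
  apply: ge0_le_integral => //.
  - by move=> t _; rewrite lee_fin normc_ge0.
  - by apply: measurable_funTS; exact: measurable_circle_diff.
  - apply: measurable_funTS; apply: emeasurable_funD.
      exact: measurable_circle_sum.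
    exact: (measurable_circle_f af r01).
  - move=> t _; rewrite -EFinD lee_fin -[leRHS]addrC addrC.
    by rewrite (le_trans (ler_normcD _ _))// normcNE.
rewrite -EFinD -EFinM lee_fin.
have -> : Num.sqrt (1 - rho ^+ 2) = s * Num.sqrt (1 + rho).
  by rewrite -sqrtrM ?subr_ge0 ?(ltW r1)//; congr Num.sqrt; ring.
set v := Num.sqrt (1 + rho).
have v0 : 0 < v by rewrite sqrtr_gt0; lra.
have v2 : v <= 2.
  by rewrite -(@ler_pXn2r _ 2) ?nnegrE ?(ltW v0)// sqr_sqrtr; lra.
have sv : s * v <= s * 2 by rewrite ler_pM2l.
have s1' : 1 <= s^-1 by rewrite invf_ge1.
have v1' : 1 <= 2 * v^-1 by rewrite ler_pdivlMr// mul1r.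
have : C <= C * s^-1 by rewrite ler_peMr.
rewrite invfM => Cs.
have : C / s * 1 <= C / s * (2 * v^-1).
  by rewrite ler_wpM2l// divr_ge0// ltW.
have -> : 4 * C * (s^-1 * v^-1) = 2 * (C / s * (2 * v^-1)) by ring.
lra.
Qed.

End Main.

Theorem theorem1p2 (R : realType) (f : R[i] -> R[i]) (a : nat -> R[i])
    (hf : hardyH1 f)
    (ha : forall z : R[i], unit_disc z ->
      (partial_sum a N z : R[i]^o) @[N --> \oo] --> (f z : R[i]^o)) :
  A1norm (fun z => partial_sum a N z - f z) @[N --> \oo] --> 0%E.
Proof.
have [C C0 fC] := hardy_circle hf.
have p0 := @twopi_gt0 R.
pose TR := measurableTypeR R.
pose area := (@lebesgue_measure R \x @lebesgue_measure R)%E.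
pose W (p : TR * TR) : \bar R := (if p.1 ^+ 2 + p.2 ^+ 2 < 1 then
     (Num.sqrt (1 - (p.1 ^+ 2 + p.2 ^+ 2)))^-1 else 0)%R%:E.
have mW : measurable_fun [set: TR * TR] W.
  apply/measurable_EFinP/measurable_cut; first exact: measurable_sqnorm.
  apply: measurable_sqrtV; apply: measurable_funB; first exact: measurable_cst.
  exact: measurable_sqnorm.
have W0 p : (0 <= W p)%E.
  by rewrite lee_fin; case: ifP => // _; rewrite invr_ge0 sqrtr_ge0.
have mean N := integral_rotation_mean (measurable_disc_error ha N)
  (disc_error_ge0 f a N).
have iW : area.-integrable setT (fun p => (4 * C)%:E * W p)%E.
  apply: integrableZl => //; apply/integrableP; split => //.
  under eq_integral do rewrite gee0_abs//.
  by apply: le_lt_trans (integral_disc_weight) _; rewrite ltry.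
have mE N : measurable_fun [set: TR * TR] (circle_error f a N) := (mean N).1.
have E0 N p : (0 <= circle_error f a N p)%E.
  by apply: integral_ge0 => t _; exact: disc_error_ge0.
have cvgE : (\int[area]_p circle_error f a N p)%E @[N --> \oo] --> 0%E.
  have [] := @dominated_convergence _ (TR * TR)%type R area setT measurableT
    (circle_error f a) (cst 0%E) (fun p => (4 * C)%:E * W p)%E.
  - exact: mE.
  - exact: measurable_cst.
  - by apply: aeW => p _; exact: circle_error_cvg.
  - exact: iW.
  - by apply: aeW => p N _; rewrite gee0_abs//; exact: circle_error_le.
  - by move=> _ _; rewrite integral0.
have -> : (fun N => A1norm (fun z => partial_sum a N z - f z)) =
    (fun N => ((2 * pi)^-1)%:E * \int[area]_p circle_error f a N p)%E.
  apply/funext => N; rewrite A1norm_disc_error -(mean N).2 muleA -EFinM.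
  by rewrite mulVf ?mul1e// gt_eqF.
rewrite -(mule0 ((2 * pi)^-1)%:E).
by apply: cvgeZl.
Qed.
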